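(* Let $(X,\tau_X,E)$ be a soft topological space equipped with a soft action of a group $G$. If the action is properly soft discontinuous, then the canonical projection $(\pi,\mathrm{id}_E):(X,\tau_X,E)\to(X/G,\tau_\pi,E)$ onto the soft orbit space is a soft covering map.
   Context: Universes and parameter sets are non-empty sets. A soft set over $X$ with parameter set $A$ is a pair $(F,A)$ with $F:A\to\mathcal P(X)$. Soft unions $\bigsqcup$ and intersections $\sqcap$ are taken parameterwise; the null soft set $(0,A)$ is $a\mapsto\emptyset$ and the absolute soft set is $a\mapsto X$. A soft topology $\tau_X$ on $X$ with respect to $A$ is a family of soft sets over $X$ with parameter set $A$ containing the null and absolute soft sets and closed under arbitrary soft unions and finite soft intersections; $(X,\tau_X,A)$ is then a soft topological space and members of $\tau_X$ are called soft open. For $a\in A$, $X_a$ denotes $X$ with the slice topology $\{F(a):(F,A)\in\tau_X\}$. For $x\in X$, $x\,\widetilde\in\,(F,A)$ means $x\in F(a)$ for every $a\in A$; a soft open neighbourhood of $x$ is a soft open set $(F,A)$ with $x\,\widetilde\in\,(F,A)$. A soft map $(p,e):(X,\tau_X,A)\to(Y,\tau_Y,B)$ is a pair of maps $p:X\to Y$, $e:A\to B$. The soft image $\phi_{p,e}(F,A)$ is the soft set $b\mapsto\bigcup_{a\in e^{-1}(b)}p(F(a))$ over $Y$; the inverse soft image $\phi_{p,e}^{-1}(G,B)$ is the soft set $a\mapsto p^{-1}(G(e(a)))$ over $X$. $(p,e)$ is soft continuous (resp. soft open) if inverse soft images (resp. soft images) of soft open sets are soft open; it is soft surjective if $p$ and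 $e$ are surjective. Let $(p,e)$ be soft surjective and soft continuous. A soft open set $(G,B)$ over $Y$ is soft evenly covered by $(p,e)$ if $\phi_{p,e}^{-1}(G,B)$ is the soft union of a pairwise disjoint (pairwise soft intersections null) collection $\{(F_\alpha,A)\}_{\alpha\in\Lambda}$ of soft open sets over $X$ such that for every $\alpha\in\Lambda$ and $a\in A$ the restriction $p|_{F_\alpha(a)}:F_\alpha(a)\to G(e(a))$ is a homeomorphism for the subspace topologies induced from $X_a$ and $Y_{e(a)}$. $(p,e)$ is a soft covering map if it is soft surjective, soft continuous and soft open, and each $y\in Y$ has a soft open neighbourhood $(G,B)$ that is soft evenly covered by $(p,e)$. A (left) soft action of a group $G$ with identity $g_0$ on $(X,\tau_X,E)$ is a map $G\times X\to X$, $(g,x)\mapsto g\cdot x$, with $g_0\cdot x=x$, $(gh)\cdot x=g\cdot(h\cdot x)$ for all $g,h\in G$, $x\in X$, and such that for each $g\in G$, with $\alpha_g:x\mapsto g\cdot x$, the soft map $(\alpha_g,\mathrm{id}_E)$ is soft continuous. For $g\in G$, $g\cdot(F,E)$ denotes the soft set $e\mapsto g\cdot F(e)$. The soft action is properly soft discontinuous if for every $x\in X$ there is a soft open $(U,E)$ with $x\,\widetilde\in\,(U,E)$ and $g\cdot(U,E)\sqcap(U,E)=(0,E)$ for all $g\neq g_0$. $X/G$ is the set of orbits, $\pi:X\to X/G$, $x\mapsto G\cdot x$, and the soft orbit space is $(X/G,\tau_\pi,E)$ with $\tau_\pi=\{(H,E):\phi^{-1}_{\pi,\mathrm{id}_E}(H,E)\in\tau_X\}$.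 *)

(* Defs.v *)
From HB Require Import structures.
From mathcomp Require Import all_boot.
From mathcomp Require Import all_classical topology.

Set Implicit Arguments.
Unset Strict Implicit.
Unset Printing Implicit Defensive.

Local Open Scope classical_set_scope.

Definition soft_set (X A : Type) := A -> set X.

Section SoftSets.
Context {X A : Type}.
Implicit Types F K : soft_set X A.

Definition soft_null : soft_set X A := fun=> set0.
Definition soft_abs : soft_set X A := fun=> setT.
Definition soft_setI F K : soft_set X A := fun a => F a `&` K a.
Definition soft_bigcup (I : Type) (F : I -> soft_set X A) : soft_set X A :=
  fun a => \bigcup_i F i a.
Definition soft_mem (x : X) F := forall a, F a x.

End SoftSets.

(* Universes and parameter sets are non-empty by convention. Closure under
   finite soft intersections is given by its nullary (absolute soft set) and
   binary cases. *)
Record softTopology (X A : Type) := SoftTopology {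
  soft_open : set (soft_set X A);
  soft_universe_inh : inhabited X;
  soft_param_inh : inhabited A;
  soft_open_null : soft_open soft_null;
  soft_open_abs : soft_open soft_abs;
  soft_openI : forall F K,
    soft_open F -> soft_open K -> soft_open (soft_setI F K);
  soft_open_bigcup : forall (I : Type) (F : I -> soft_set X A),
    (forall i, soft_open (F i)) -> soft_open (soft_bigcup F) }.

(* The set X with the topology [set F a | F soft open]. *)
Definition slice (X A : Type) (tau : softTopology X A) (a : A) : Type := X.

Section SliceTopology.
Variables (X A : Type) (tau : softTopology X A) (a : A).

HB.instance Definition _ := gen_eqMixin (slice tau a).
HB.instance Definition _ := gen_choiceMixin (slice tau a).

Definition slice_open : set (set (slice tau a)) :=
  [set U | exists2 F, soft_open tau F & F a = U].

Let slice_openT : slice_open setT.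
Proof. by exists soft_abs => //; exact: soft_open_abs. Qed.

Let slice_openI : setI_closed slice_open.
Proof.
move=> _ _ [F oF <-] [K oK <-]; exists (soft_setI F K) => //.
exact: soft_openI.
Qed.

Let slice_open_bigU (I : Type) (f : I -> set (slice tau a)) :
  (forall i, slice_open (f i)) -> slice_open (\bigcup_i f i).
Proof.
move=> fo.
have /choice[F HF] : forall i, exists F, soft_open tau F /\ F a = f i.
  by move=> i; have [F oF Fa] := fo i; exists F.
exists (soft_bigcup F); first by apply: soft_open_bigcup => i; case: (HF i).
by apply: eq_bigcupr => i _; case: (HF i).
Qed.

HB.instance Definition _ :=
  isOpenTopological.Build (slice tau a) slice_openT slice_openI slice_open_bigU.

End SliceTopology.

(* The restriction of p is a homeomorphism S -> T; the types set_type S and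
   set_type T carry the subspace topologies. *)
Definition restr_homeomorphism (U V : topologicalType) (p : U -> V)
    (S : set U) (T : set V) :=
  exists (f : set_type S -> set_type T) (f' : set_type T -> set_type S),
    [/\ forall x, set_val (f x) = p (set_val x),
        cancel f f', cancel f' f, continuous f & continuous f'].

Section SoftMaps.
Context {X A Y B : Type}.

Definition soft_image (p : X -> Y) (e : A -> B) (F : soft_set X A) :
    soft_set Y B :=
  fun b => \bigcup_(a in e @^-1` [set b]) (p @` F a).

Definition soft_preimage (p : X -> Y) (e : A -> B) (K : soft_set Y B) :
    soft_set X A :=
  fun a => p @^-1` K (e a).

Variables (tau : softTopology X A) (sigma : softTopology Y B).
Variables (p : X -> Y) (e : A -> B).

Definition soft_continuous :=
  forall K, soft_open sigma K -> soft_open tau (soft_preimage p e K).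

Definition soft_open_map :=
  forall F, soft_open tau F -> soft_open sigma (soft_image p e F).

Definition soft_surjective :=
  set_surj [set: X] [set: Y] p /\ set_surj [set: A] [set: B] e.

Definition soft_evenly_covered (K : soft_set Y B) :=
  exists (L : Type) (F : L -> soft_set X A),
    [/\ forall l, soft_open tau (F l),
        forall l m, l <> m -> soft_setI (F l) (F m) = soft_null,
        soft_preimage p e K = soft_bigcup F
      & forall l a, @restr_homeomorphism (slice tau a) (slice sigma (e a)) p
                      (F l a) (K (e a))].

Definition soft_covering_map :=
  [/\ soft_surjective, soft_continuous, soft_open_map
    & forall y, exists K,
        [/\ soft_open sigma K, soft_mem y K & soft_evenly_covered K]].

End SoftMaps.

Record softAction (G : groupType) (X E : Type) (tau : softTopology X E) :=
  SoftAction {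
    soft_act :> G -> X -> X;
    soft_act1 : forall x, soft_act 1%g x = x;
    soft_actM : forall g h x, soft_act (g * h)%g x = soft_act g (soft_act h x);
    soft_act_continuous : forall g, soft_continuous tau tau (soft_act g) id }.

Section SoftOrbits.
Context {G : groupType} {X E : Type} {tau : softTopology X E}.
Variable act : softAction G tau.

Definition soft_translate (g : G) (F : soft_set X E) : soft_set X E :=
  fun a => act g @` F a.

Definition properly_soft_discontinuous :=
  forall x, exists U,
    [/\ soft_open tau U, soft_mem x U
      & forall g, g <> 1%g -> soft_setI (soft_translate g U) U = soft_null].

Definition soft_orbit (x : X) : set X := range (fun g => act g x).

Definition orbit_space : Type := set_type (range soft_orbit).

Definition orbit_proj (x : X) : orbit_space :=
  SigSub (mem_set (imageT soft_orbit x)).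

Definition orbit_soft_open : set (soft_set orbit_space E) :=
  [set H | soft_open tau (soft_preimage orbit_proj id H)].

Let orbit_space_inh : inhabited orbit_space.
Proof. by have [x] := soft_universe_inh tau; exists; exact: orbit_proj x. Qed.

Let orbit_open_null : orbit_soft_open soft_null.
Proof. exact: soft_open_null. Qed.

Let orbit_open_abs : orbit_soft_open soft_abs.
Proof. exact: soft_open_abs. Qed.

Let orbit_openI F K :
  orbit_soft_open F -> orbit_soft_open K -> orbit_soft_open (soft_setI F K).
Proof. by move=> oF oK; exact: (soft_openI oF oK). Qed.

Let orbit_open_bigcup (I : Type) (F : I -> soft_set orbit_space E) :
  (forall i, orbit_soft_open (F i)) -> orbit_soft_open (soft_bigcup F).
Proof. by move=> oF; exact: (soft_open_bigcup oF). Qed.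

Definition orbit_topology : softTopology orbit_space E :=
  SoftTopology orbit_space_inh (soft_param_inh tau) orbit_open_null
    orbit_open_abs orbit_openI orbit_open_bigcup.

End SoftOrbits.

(* Main.v *)
(** Translation by [g] is a soft homeomorphism with inverse translation by
    [g^-1], so the saturation of a soft open set is a union of soft open
    translates and the projection is soft open. The image of a neighbourhood [U]
    whose nontrivial translates miss [U] is evenly covered by the translates of
    [U]: these are disjoint, and on each of them the projection is injective,
    continuous and open. *)
Require Import Defs.
From mathcomp Require Import all_boot all_classical topology.

Local Open Scope classical_set_scope.

(** Continuity of the inverse rests on [S] being open: an open subset of [S] is then open in [U], so
    [p] sends it to an open set. *)
Lemma restr_homeomorphism_open_inj (U V : topologicalType) (p : U -> V)
    (S : set U) (T : set V) :
  continuous p -> (forall W, open W -> open (p @` W)) -> open S ->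
  set_inj S p -> p @` S = T -> restr_homeomorphism p S T.
Proof.
move=> cp op oS injp imp.
have fP (x : set_type S) : p (set_val x) \in T.
  by rewrite -imp; apply/mem_set/imageP/set_valP.
pose f (x : set_type S) : set_type T := SigSub (fP x).
have /choice[f' f'P] (y : set_type T) : exists x : set_type S, f x = y.
  have : T (set_val y) by exact: set_valP.
  rewrite -{1}imp => -[x Sx pxy].
  by exists (SigSub (mem_set Sx)); exact: val_inj.
have injf : injective f.
  move=> x y /(congr1 set_val) fxy; apply: val_inj.
  by apply: injp fxy; apply/mem_set/set_valP.
have fK : cancel f f' by move=> x; exact: injf.
exists f, f'; split => //.
- apply/continuousP => _ [W oW <-].
  exists (p @^-1` W) => //.
  exact: open_comp.
- apply/continuousP => _ [W oW <-].
  (* Without the intersection with [S], the image could contain points of [T] hit by [W] only from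
     outside [S]. *)
  exists (p @` (W `&` S)); first by apply/op/openI.
  apply/seteqP; split => y /=.
  + case=> x [Wx Sx] pxy.
    suff -> : f' y = SigSub (mem_set Sx) by [].
    by apply: injf; rewrite f'P; apply: val_inj.
  + move=> Wy; exists (set_val (f' y)); first by split=> //; exact: set_valP.
    by rewrite -[in RHS](f'P y).
Qed.

Section SoftMapSlices.
Context {X A Y : Type} {tau : softTopology X A} {sigma : softTopology Y A}.
Variable p : X -> Y.

Lemma soft_imageE (F : soft_set X A) a : soft_image p id F a = p @` F a.
Proof.
by apply/seteqP; split=> [y [_ ->]//|y py]; exists a.
Qed.

(** An open set of a slice is the value at [a] of a soft open set, whose soft preimage is the
    witness needed. *)
Lemma soft_continuous_slice a : soft_continuous tau sigma p id ->
  continuous (p : slice tau a -> slice sigma a).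
Proof.
move=> cp; apply/continuousP => _ [K oK <-].
by exists (soft_preimage p id K) => //; exact: cp.
Qed.

Lemma soft_open_map_slice a (W : set (slice tau a)) :
  soft_open_map tau sigma p id -> open W ->
  open ((p : slice tau a -> slice sigma a) @` W).
Proof.
move=> op [F oF <-].
by exists (soft_image p id F); [exact: op|exact: soft_imageE].
Qed.

End SoftMapSlices.

Section OrbitProjection.
Context {G : groupType} {X E : Type} {tau : softTopology X E}.
Variable act : softAction G tau.

Lemma soft_actK g : cancel (act g) (act g^-1%g).
Proof. by move=> x; rewrite -soft_actM mulVg soft_act1. Qed.

Lemma soft_actVK g : cancel (act g^-1%g) (act g).
Proof. by move=> x; rewrite -soft_actM mulgV soft_act1. Qed.

(** Reduces openness of translates to soft continuity of the action of [g^-1]. *)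
Lemma soft_translateE g (F : soft_set X E) :
  soft_translate act g F = soft_preimage (act g^-1%g) id F.
Proof.
apply/funext => a; apply/seteqP; split => [_ [x Fx <-]|x Fx].
  by rewrite /soft_preimage /= soft_actK.
by exists (act g^-1%g x) => //; rewrite soft_actVK.
Qed.

Lemma soft_open_translate g (F : soft_set X E) :
  soft_open tau F -> soft_open tau (soft_translate act g F).
Proof. by rewrite soft_translateE; exact: soft_act_continuous. Qed.

Lemma orbit_projP x y :
  orbit_proj act x = orbit_proj act y <-> exists g, act g x = y.
Proof.
split=> [/(congr1 set_val) xy|[g <-]].
  have : set_val (orbit_proj act y) y by exists 1%g => //; exact: soft_act1.
  by rewrite -xy => -[g _ <-]; exists g.
(* The two inclusions of orbits come from reindexing by right multiplication by [g^-1] and by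
   [g]. *)
apply: val_inj; apply/seteqP; split => /= _ [h _ <-].
  by exists (h * g^-1)%g => //; rewrite soft_actM soft_actK.
by exists (h * g)%g => //; rewrite soft_actM.
Qed.

Lemma orbit_proj_surj : soft_surjective (orbit_proj act) (@id E).
Proof.
split=> [[O OP] _|a _]; last by exists a.
by have [x _ xO] := set_mem OP; exists x => //; exact: val_inj.
Qed.

(** Immediate, since [orbit_topology] is the quotient topology. *)
Lemma orbit_proj_continuous :
  soft_continuous tau (orbit_topology act) (orbit_proj act) id.
Proof. by []. Qed.

(** Used twice: it makes the projection open and splits the preimage of the image of [U] into
    sheets. *)
Lemma orbit_proj_saturation (F : soft_set X E) :
  soft_preimage (orbit_proj act) id (soft_image (orbit_proj act) id F) =
  soft_bigcup (fun g => soft_translate act g F).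
Proof.
apply/funext => a; rewrite /soft_preimage soft_imageE.
apply/seteqP; split => [x [u Fu /orbit_projP[g gux]]|_ [g _ [u Fu <-]]].
  by exists g => //; exists u.
by exists u => //; apply/orbit_projP; exists g.
Qed.

Lemma orbit_proj_open :
  soft_open_map tau (orbit_topology act) (orbit_proj act) id.
Proof.
move=> F oF; rewrite /= /orbit_soft_open /= orbit_proj_saturation.
by apply: soft_open_bigcup => g; exact: soft_open_translate.
Qed.

Section DisjointTranslates.
Variable U : soft_set X E.
Hypothesis oU : soft_open tau U.
Hypothesis disjU : forall g, g <> 1%g ->
  soft_setI (soft_translate act g U) U = soft_null.

Lemma act_in_disjoint g a u : U a u -> U a (act g u) -> g = 1%g.
Proof.
move=> Uu Ugu; apply: contrapT => /disjU/(congr1 (@^~ a)) dU.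
suff : (set0 : set X) (act g u) by [].
by rewrite -[set0]dU; split=> //; exists u.
Qed.

Lemma translates_disjoint g h : g <> h ->
  soft_setI (soft_translate act g U) (soft_translate act h U) = soft_null.
Proof.
move=> gh; apply/funext => a; apply/seteqP; split=> // _ [[u Uu <-]] [v Uv vu].
(* A common point [act g u = act h v] means that [h^-1 * g] moves [u] to [v] inside [U], hence is
   trivial. *)
apply: gh; apply: (mulgI h^-1%g); rewrite mulVg.
by apply: (act_in_disjoint _ _ _ Uu); rewrite soft_actM -vu soft_actK.
Qed.

Lemma orbit_proj_inj_translate g a :
  set_inj (soft_translate act g U a) (orbit_proj act).
Proof.
move=> _ _ /set_mem[u Uu <-] /set_mem[v Uv <-] /orbit_projP[h huv].
(* Conjugating by [g] brings the comparison back to [U]: this element sends [u] to [v], and its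
   triviality then gives [u = v]. *)
have k1 : (g^-1 * (h * g))%g = 1%g.
  by apply: (act_in_disjoint _ _ _ Uu); rewrite !soft_actM huv soft_actK.
congr (act g _).
by rewrite -[LHS](soft_act1 act) -k1 !soft_actM huv soft_actK.
Qed.

Lemma orbit_proj_translate g a : orbit_proj act @` soft_translate act g U a =
  orbit_proj act @` U a.
Proof.
have pg u : orbit_proj act (act g u) = orbit_proj act u.
  by apply/esym/orbit_projP; exists g.
apply/seteqP; split => _ [x Ux <-].
  by case: Ux => u Uu <-; rewrite pg; exact: imageP.
by rewrite -pg; apply: imageP; exact: imageP.
Qed.

Lemma image_evenly_covered :
  soft_evenly_covered tau (orbit_topology act) (orbit_proj act) id
    (soft_image (orbit_proj act) id U).
Proof.
exists G, (fun g => soft_translate act g U); split.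
- by move=> g; exact: soft_open_translate.
- exact: translates_disjoint.
- exact: orbit_proj_saturation.
- move=> g a; apply: restr_homeomorphism_open_inj.
  + exact/soft_continuous_slice/orbit_proj_continuous.
  + by move=> W; exact/soft_open_map_slice/orbit_proj_open.
  + by exists (soft_translate act g U) => //; exact: soft_open_translate.
  + exact: orbit_proj_inj_translate.
  + by rewrite soft_imageE; exact: orbit_proj_translate.
Qed.

End DisjointTranslates.

End OrbitProjection.

Theorem theorem6p0p5 (G : groupType) (X E : Type) (tau : softTopology X E)
    (act : softAction G tau) (hact : properly_soft_discontinuous act) :
  soft_covering_map tau (orbit_topology act) (orbit_proj act) id.
Proof.
split; [exact: orbit_proj_surj|exact: orbit_proj_continuous|
  exact: orbit_proj_open|move=> y].
(* Proper discontinuity concerns points of [X], so a representative of the orbit is chosen first. *)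
have [x _ <-] := (orbit_proj_surj act).1 y I.
have [U [oU Ux disjU]] := hact x.
exists (soft_image (orbit_proj act) id U); split.
- exact: orbit_proj_open.
- by move=> a; rewrite soft_imageE; exact/imageP/Ux.
- exact: image_evenly_covered.
Qed.
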